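(* Let $f$ belong to the Laguerre-Pólya class, satisfy $f''-2af'+bf=0$, and have only simple zeros. Let $t=f'/f$ and $\Delta(x)=b(x)-a^2(x)$. Suppose that $a(x)$ intersects $t(x)$ between zeros $x_i<x_j$ of $f$ (that is, there is $c$ with $x_i<c<x_j$ and $a(c)=t(c)$). Then $$(x_i-x_j)^2\ \ge\ \min_{x_i<x<x_j}\frac{8}{\Delta(x)}.$$
   Context: The Laguerre-Pólya class consists of real polynomials having only real zeros and of real entire functions having a representation of the form $c\,x^m e^{-\alpha x^2+\beta x}\prod_{i=1}^{\infty}\left(1-\frac{x}{x_i}\right)e^{x/x_i}$, where $c,\beta,x_i$ are real, $\alpha\ge 0$, $m$ is a nonnegative integer and $\sum x_i^{-2}<\infty$. The function $f$ is not identically zero. The functions $a,b$ are real-valued functions of a real variable (possibly undefined at some points), and the equation $f''-2af'+bf=0$ holds at all real points where $a,b$ are defined. The logarithmic derivative is $t(x)=f'(x)/f(x)$ and the discriminant is $\Delta(x)=b(x)-a^2(x)$. A minimum that is not attained is read as an infimum. *)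

(* Defs.v *)
From HB Require Import structures.
From mathcomp Require Import all_boot all_order all_algebra.
From mathcomp Require Import complex.
From mathcomp Require Import all_classical all_reals all_analysis.
Set Implicit Arguments.
Unset Strict Implicit.
Unset Printing Implicit Defensive.
Import Order.TTheory GRing.Theory Num.Theory numFieldNormedType.Exports.
Local Open Scope classical_set_scope.
Local Open Scope ring_scope.

(* Entire functions that are real on the real axis are represented by their
   restrictions to the real line, i.e. by the sums of real power series with
   infinite radius of convergence. *)
Definition real_entire (R : realType) (f : R -> R) : Prop :=
  exists u : R^nat, forall x, series (fun n => u n * x ^+ n) @ \oo --> f x.

Definition only_real_zeros (R : realType) (p : {poly R}) : Prop :=
  forall z : R[i], root (map_poly (real_complex R) p) z -> complex.Im z = 0.

Definition genus1_factor (R : realType) (r x : R) : R :=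
  (1 - x / r) * expR (x / r).

(* The canonical product may be infinite or, as is usual, finite (possibly
   empty), so that for instance expR (- x ^+ 2) belongs to the class.  Values
   may be repeated in the family r: this is how multiplicities are counted. *)
Definition canonical_product (R : realType) (P : R -> R) : Prop :=
  (exists (n : nat) (r : 'I_n -> R), (forall i, r i != 0) /\
     forall x, P x = \prod_(i < n) genus1_factor (r i) x) \/
  (exists r : R^nat,
     [/\ forall i, r i != 0,
         cvgn (series (fun i => (r i) ^- 2)) &
         forall x, (fun n => \prod_(i < n) genus1_factor (r i) x) @ \oo
                   --> P x]).

Definition laguerre_polya (R : realType) (f : R -> R) : Prop :=
  (exists p : {poly R}, only_real_zeros p /\ forall x, f x = p.[x]) \/
  (real_entire f /\
   exists (c alpha beta : R) (m : nat) (P : R -> R),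
     [/\ 0 <= alpha, canonical_product P &
         forall x, f x =
           c * x ^+ m * expR (- alpha * x ^+ 2 + beta * x) * P x]).

(* D is the set of points at which the coefficients a and b are both defined;
   their values outside D are irrelevant. *)
Definition satisfies_ode (R : realType) (f a b : R -> R) (D : set R) : Prop :=
  forall x, D x ->
    derive1n 2 f x - 2 * a x * derive1 f x + b x * f x = 0.

(* Members of the Laguerre-Polya class have no non-real zeros, so only real
   points need to be considered. *)
Definition only_simple_zeros (R : realType) (f : R -> R) : Prop :=
  forall x, f x = 0 -> derive1 f x != 0.

(* Meaningful only where f x != 0. *)
Definition log_derivative (R : realType) (f : R -> R) (x : R) : R :=
  derive1 f x / f x.

Definition discriminant (R : realType) (a b : R -> R) (x : R) : R :=
  b x - a x ^+ 2.

(* Main.v *)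
Require Import Defs.
From HB Require Import structures.
From mathcomp Require Import all_boot all_order all_algebra.
From mathcomp Require Import ring lra complex.
From mathcomp Require Import all_classical all_reals all_analysis.
Set Implicit Arguments.
Unset Strict Implicit.
Unset Printing Implicit Defensive.
Import Order.TTheory GRing.Theory Num.Theory numFieldNormedType.Exports.
Local Open Scope classical_set_scope.
Local Open Scope ring_scope.

(** Write t = f'/f.  Where a = t, substituting the differential equation in the
    discriminant gives b - a^2 = - t' = (f'^2 - f f'') / f^2.  Differentiating
    the logarithm of the product formula of f term by term would give
      - t'(c) = 2 alpha + sum over the zeros z of 1 / (c - z)^2,
    and keeping only the terms of xi and xj, then using convexity, bounds this
    below by 1 / (c - xi)^2 + 1 / (c - xj)^2 >= 8 / (xi - xj)^2.  Hence the
    crossing point c itself is a witness: 8 / Delta(c) <= (xi - xj)^2.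

    Termwise differentiation of an infinite product is avoided by comparing f
    at two points symmetric about c.  A factor vanishing only at z satisfies
      g(c + s) g(c - s) = g(c)^2 (1 - s^2 / (c - z)^2),
    while the Gaussian factor contributes exp(- 2 alpha s^2) <= 1.  If |s| is at
    most the distance from c to the nearest zero, all the weights
    1 - s^2 / (c - z)^2 lie in [0, 1], and dropping all but those of xi and xj
    leaves an inequality between values of f at three points
    (laguerre_polya_reflect).  Such an inequality survives the pointwise limit
    of the partial products, the only convergence that the product formula
    provides.  Its two sides agree to first order at s = 0, so their second
    derivatives there are ordered, which is the bound wanted for
    f'^2 - f f'' (laguerre_polya_log_concavity).

    Two facts connect the class with this argument: f is twice differentiable,
    as a polynomial or as the sum of an everywhere convergent power series, and xi and xj really
    are zeros of factors, because a convergent genus one product does not vanish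
    elsewhere (genus1_product_neq0). *)

(** * Second derivatives of entire functions *)

(** For y >= max(1, |x|), (i + 1) |x|^i <= (2 y)^(i + 1): the factor produced by
    differentiation is absorbed by doubling the radius. *)
Lemma pseries_diffs_cvg (R : realType) (u : R^nat) :
  (forall x, cvgn (pseries u x)) -> forall x, cvgn (pseries (pseries_diffs u) x).
Proof.
move=> cu x; pose y := 1 + `|x|.
have y1 : 1 <= y by rewrite lerDl.
have y0 : 0 < y by exact: lt_le_trans y1.
have xy : `|x| <= y by rewrite lerDr.
have cabs : cvgn (pseries (fun i => `|u i|) (2 * y)).
  apply: (is_cvg_pseries_inside_norm (x := 3 * y)) => //.
  by rewrite !normrM (gtr0_norm y0) !normr_nat ltr_pM2r // ltr_nat.
apply: normed_cvg; rewrite /normed_series_of /=.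
apply: (series_le_cvg (v_ := fun i => `|u i.+1| * (2 * y) ^+ i.+1)) => [n|n|n|] //=.
- by rewrite mulr_ge0 // exprn_ge0 // mulr_ge0 // ltW.
- rewrite /pseries_diffs !normrM normrX normr_nat -mulrA mulrCA.
  apply: ler_wpM2l => //; rewrite exprMn; apply: ler_pM => //.
  + by rewrite -natrX ler_nat ltnW // ltn_expl.
  + rewrite exprS -[leLHS]mul1r; apply: ler_pM => //.
    by rewrite lerXn2r // nnegrE // ltW.
have := cabs; rewrite /pseries -[X in cvgn X]/(series _).
move=> /cvg_ex[l cl]; apply/cvg_ex; exists (l - `|u 0%N|).
rewrite [X in X @ \oo](_ : _ = (fun n =>
  series (fun i => `|u i| * (2 * y) ^+ i) n.+1 - `|u 0%N|)); last first.
  by apply/funext => n; rewrite /series /= big_nat_recl //= expr0 mulr1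
    [X in X - _]addrC addrK.
by apply: cvgB; [rewrite cvg_shiftS|exact: cvg_cst].
Qed.

Lemma real_entire_derive (R : realType) (f : R -> R) : real_entire f ->
  exists2 g, real_entire g & forall x, is_derive x (1 : R) f (g x).
Proof.
move=> [u uf].
have cu x : cvgn (pseries u x) by apply/cvg_ex; exists (f x); exact: uf.
have fE : f = fun x => limn (pseries u x).
  by apply/funext => x; apply/esym/cvg_lim => //; exact: uf.
have cdu := pseries_diffs_cvg cu.
have cddu := pseries_diffs_cvg cdu.
exists (fun x => limn (pseries (pseries_diffs u) x)).
  by exists (pseries_diffs u) => x; exact: cdu.
move=> x; rewrite fE; apply: (@pseries_snd_diffs _ _ (1 + `|x|)) => //.
by rewrite [ltRHS]ger0_norm ?addr_ge0 // ltrDr.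
Qed.

Lemma laguerre_polya_derive2 (R : realType) (f : R -> R) : laguerre_polya f ->
  exists f1 f2 : R -> R, (forall x, is_derive x (1 : R) f (f1 x)) /\
    (forall x, is_derive x (1 : R) f1 (f2 x)).
Proof.
case=> [[p [_ fE]]|[/real_entire_derive[f1 + ff1] _]].
  exists (horner p^`()), (horner p^`()^`()).
  by split=> x; [rewrite (funext fE)|]; exact: is_derive_poly.
by move=> /real_entire_derive[f2 _ f12]; exists f1, f2.
Qed.

(** Since F and F' vanish at 0, a negative second derivative there would make F'
    and hence F negative just to the right of 0. *)
Lemma min_snd_derive_ge0 (R : realType) (F F1 : R -> R) (F2 d : R) :
  (forall x, is_derive x (1 : R) F (F1 x)) -> is_derive (0 : R) (1 : R) F1 F2 ->
  F 0 = 0 -> F1 0 = 0 -> 0 < d -> (forall s, 0 < s < d -> 0 <= F s) -> 0 <= F2.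
Proof.
move=> dF [dF1 F1E] F0 F10 d0 Fge0; rewrite leNgt; apply/negP => F2neg.
have cF1 : h^-1 *: (F1 (h *: 1 + 0) - F1 0) @[h --> 0^'] --> F2.
  by rewrite -F1E; exact: dF1.
have : \forall h \near 0^', h^-1 *: (F1 (h *: 1 + 0) - F1 0) < 0.
  by apply: cvgr_lt cF1 _ _.
move=> /nbhs_ballP[e /= e0 He].
have F1neg h : 0 < h < e -> F1 h < 0.
  move=> /andP[h0 he]; have := He h.
  rewrite /ball /= sub0r normrN gtr0_norm // => /(_ he).
  rewrite gt_eqF // => /(_ isT).
  by rewrite F10 subr0 addr0 /GRing.scale /= mulr1 pmulr_rlt0 // invr_gt0.
pose m := Num.min e d / 2.
have m0 : 0 < m by rewrite divr_gt0 // lt_min e0.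
have mm : m < Num.min e d.
  by rewrite /m ltr_pdivrMr // ltr_pMr ?lt_min ?e0 // ltr1n.
move: mm; rewrite lt_min => /andP[me md].
have cF : {within `[0, m], continuous F}.
  apply: continuous_subspaceT => x.
  by apply/differentiable_continuous/derivable1_diffP; case: (dF x).
have [x xm] := MVT m0 (fun x _ => dF x) cF.
move: xm; rewrite in_itv /= F0 !subr0 => /andP[x0 xm] FE.
have : 0 <= F m by rewrite Fge0 // m0.
by rewrite FE leNgt nmulr_rlt0 ?m0 // F1neg // x0 (lt_trans xm).
Qed.

(** * Real zeros and factors *)

(** Over the algebraically closed R[i] some root exists; having no imaginary part, it
    is a root over R and can be divided out. *)
Lemma real_zeros_split (R : realType) (p : {poly R}) : only_real_zeros p ->
  exists Z : seq R, p = lead_coef p *: \prod_(z <- Z) ('X - z%:P).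
Proof.
have [n] := ubnP (size p); elim: n p => // n IHn p; rewrite ltnS => sp preal.
have [p1|p1] := eqVneq (size p) 1%N.
  exists [::]; rewrite big_nil alg_polyC lead_coefE p1 /=.
  by apply: size1_polyC; rewrite p1.
have [z rz] : exists z, root (map_poly (real_complex R) p) z.
  by apply/closed_rootP; rewrite size_map_poly.
have := preal _ rz; case: z rz => x y rz /= y0; move: rz; rewrite {}y0.
rewrite -[X in root _ X]/(real_complex R x) fmorph_root => /factor_theorem[q pE].
have [q0|q0] := eqVneq q 0.
  by exists [::]; rewrite pE q0 mul0r lead_coef0 scale0r.
have sq : size p = (size q).+1.
  by rewrite pE size_Mmonic ?monicXsubC // size_XsubC addn2.
have [|z rz|Z qE] := IHn q; first by rewrite -sq.
  by apply: preal; rewrite pE rmorphM rootM rz.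
exists (x :: Z); rewrite big_cons pE lead_coef_Mmonic ?monicXsubC //.
by rewrite [LHS]mulrC {1}qE scalerAr.
Qed.

Lemma prod_le_two_factors (R : realType) (T : eqType) (Z : seq T) (w : T -> R) x y :
  {in Z, forall z, 0 <= w z <= 1} -> x \in Z -> y \in Z -> x != y ->
  \prod_(z <- Z) w z <= w x * w y.
Proof.
move=> w01 xZ yZ xy; have yZ' : y \in rem x Z by rewrite rem_mem // eq_sym.
have w01' : forall z, z \in rem y (rem x Z) -> 0 <= w z <= 1.
  by move=> z /mem_rem /mem_rem /w01.
rewrite (perm_big _ (perm_to_rem xZ)) big_cons (perm_big _ (perm_to_rem yZ')) big_cons.
have /andP[wx0 _] := w01 _ xZ; have /andP[wy0 _] := w01 _ yZ.
rewrite ler_wpM2l // ler_piMr // big_seq prodr_ile1 //.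
Qed.

Lemma genus1_factor_neq0 (R : realType) (r x : R) :
  r != 0 -> r != x -> genus1_factor r x != 0.
Proof.
move=> r0 rx; rewrite /genus1_factor mulf_neq0 ?(gt_eqF (expR_gt0 _)) // subr_eq0 eq_sym.
by apply: contra_neq rx => /divr1_eq ->.
Qed.

(** The Weierstrass product inequality. *)
Lemma one_sub_sum_le_prod (R : realType) (I : eqType) (s : seq I) (a : I -> R) :
  {in s, forall i, 0 <= a i <= 1} ->
  1 - \sum_(i <- s) a i <= \prod_(i <- s) (1 - a i).
Proof.
elim: s => [_|i s IHs a01]; first by rewrite !big_nil subr0.
have /andP[ai0 ai1] := a01 i (mem_head _ _).
have a01s : {in s, forall i, 0 <= a i <= 1}.
  by move=> j js; apply: a01; rewrite inE js orbT.
have {}IHs := IHs a01s; rewrite !big_cons.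
apply: (@le_trans _ _ ((1 - a i) * (1 - \sum_(j <- s) a j))).
  have : 0 <= \sum_(j <- s) a j by rewrite big_seq sumr_ge0 // => j /a01s/andP[].
  move=> S0; have := mulr_ge0 ai0 S0; lra.
by rewrite ler_wpM2l // subr_ge0.
Qed.

(** From exp u >= 1 + u, multiplied by 1 - u >= 0. *)
Lemma genus1_factor_ge (R : realType) (r x : R) :
  (x / r) ^+ 2 <= 1 -> 1 - (x / r) ^+ 2 <= genus1_factor r x.
Proof.
move=> u1; rewrite /genus1_factor; set u := x / r in u1 *.
have : u <= 1 by rewrite leNgt; apply/negP => ?; nra.
move=> ul; have -> : 1 - u ^+ 2 = (1 - u) * (1 + u) by ring.
by rewrite ler_wpM2l ?subr_ge0 // expR_ge1Dx.
Qed.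

(** The tail of the product beyond some N is at least 1 - sum of (x / r i)^2, so at
    least 1 / 2 once the tail of the convergent sum is at most 1 / 2, and the
    finitely many earlier factors are nonzero. *)
Lemma genus1_product_neq0 (R : realType) (r : R^nat) (P : R -> R) (x : R) :
  (forall i, r i != 0) -> cvgn (series (fun i => (r i) ^- 2)) ->
  (fun n => \prod_(i < n) genus1_factor (r i) x) @ \oo --> P x ->
  (forall i, r i != x) -> P x != 0.
Proof.
move=> r0 cr cP rx.
pose a i := (x / r i) ^+ 2.
have a0 i : 0 <= a i by exact: sqr_ge0.
have ca : cvgn (series a).
  have -> : a = x ^+ 2 *: (fun i => (r i) ^- 2).
    by apply/funext => i; rewrite /a /= expr_div_n.
  exact: is_cvg_seriesZ.
have /cvg_cauchy/cauchy_seriesP/(_ (1 / 2) ltac:(by rewrite divr_gt0)) := ca.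
move=> [[A B] /= [[NA _ HA] [NB _ HB]] AB].
pose N := maxn NA NB.
have tail n : (N <= n)%N -> \sum_(N <= k < n) a k < 1 / 2.
  move=> Nn; have := AB (N, n) _; rewrite /= ger0_norm ?sumr_ge0 //; apply.
  split; first by apply: HA; exact: leq_maxl.
  by apply: HB; exact: leq_trans (leq_maxr _ _) Nn.
have a_lt1 k : (N <= k)%N -> a k <= 1 / 2.
  move=> Nk; have := tail k.+1 (leqW Nk); rewrite big_nat_recr //= => /ltW.
  by apply: le_trans; rewrite lerDr sumr_ge0.
pose Q n := \prod_(0 <= i < n) genus1_factor (r i) x.
have QE : (fun n => \prod_(i < n) genus1_factor (r i) x) = Q.
  by apply/funext => n; rewrite /Q big_mkord.
have QN0 : Q N != 0.
  by rewrite prodf_seq_neq0; apply/allP => i _; exact: genus1_factor_neq0.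
have tail_ge n : (N <= n)%N -> 1 / 2 <= \prod_(N <= i < n) genus1_factor (r i) x.
  move=> Nn; apply: (@le_trans _ _ (1 - \sum_(i <- index_iota N n) a i)).
    by have := tail n Nn; lra.
  apply: (@le_trans _ _ (\prod_(i <- index_iota N n) (1 - a i))).
    apply: one_sub_sum_le_prod => i; rewrite mem_index_iota => /andP[Ni _].
    by rewrite a0 (le_trans (a_lt1 _ Ni)) //; lra.
  rewrite big_seq [leRHS]big_seq; apply: ler_prod => i.
  rewrite mem_index_iota => /andP[Ni _]; have := a_lt1 i Ni => ai.
  by rewrite subr_ge0 genus1_factor_ge ?andbT; rewrite -?/(a i); lra.
have : `|Q N| * (1 / 2) <= `|P x|.
  rewrite QE in cP; apply: (cvgr_to_ge (cvg_norm cP)).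
  exists N => // n /= Nn; rewrite /Q (big_cat_nat (leq0n N) Nn) //= normrM ler_wpM2l //.
  by rewrite (le_trans (tail_ge n Nn)) // ler_norm.
by apply: contraTneq => ->; rewrite normr0 -ltNge mulr_gt0 // normr_gt0.
Qed.

(** * Values at points symmetric about c *)

Definition reflection_weight (R : realType) (c s z : R) : R := 1 - s ^+ 2 / (c - z) ^+ 2.

Lemma reflection_weight01 (R : realType) (c s z : R) :
  `|s| <= `|c - z| -> c != z -> 0 <= reflection_weight c s z <= 1.
Proof.
move=> sz cz; have d0 : 0 < (c - z) ^+ 2 by rewrite exprn_even_gt0 //= subr_eq0.
rewrite /reflection_weight subr_ge0 ler_pdivrMr // mul1r lerBlDr lerDl.
rewrite divr_ge0 ?sqr_ge0 //= -real_normK ?num_real //.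
by rewrite -[leRHS]real_normK ?num_real // lerXn2r ?nnegrE.
Qed.

Lemma linear_reflect (R : realType) (c s z : R) : c != z ->
  (c + s - z) * (c - s - z) = (c - z) ^+ 2 * reflection_weight c s z.
Proof.
by move=> cz; rewrite /reflection_weight; field; rewrite subr_eq0.
Qed.

(** The convergence factor is the exponential of a linear function, so the product of
    its values at c + s and c - s is the square of its value at c: only the linear
    part contributes a weight. *)
Lemma genus1_factor_reflect (R : realType) (c s r : R) : r != 0 -> c != r ->
  genus1_factor r (c + s) * genus1_factor r (c - s) =
  genus1_factor r c ^+ 2 * reflection_weight c s r.
Proof.
move=> r0 cr; rewrite /genus1_factor.
have E : expR ((c + s) / r) * expR ((c - s) / r) = expR (c / r) ^+ 2.
  by rewrite expr2 -!expRD; congr expR; field.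
have L x : 1 - x / r = - r^-1 * (x - r) by field.
rewrite mulrACA {}E !L exprMn [RHS]mulrAC; congr (_ * _).
by rewrite mulrACA linear_reflect // exprMn expr2 mulrA.
Qed.

Lemma prod_reflect (R : realType) (I : eqType) (Z : seq I) (g : I -> R -> R)
    (z : I -> R) (c s : R) :
  {in Z, forall i, g i (c + s) * g i (c - s) =
                   g i c ^+ 2 * reflection_weight c s (z i)} ->
  (\prod_(i <- Z) g i (c + s)) * (\prod_(i <- Z) g i (c - s)) =
  (\prod_(i <- Z) g i c) ^+ 2 * \prod_(i <- Z) reflection_weight c s (z i).
Proof.
move=> gZ; rewrite -prodrXl -!big_split big_seq [RHS]big_seq.
exact: eq_bigr.
Qed.

Definition hadamard_product (R : realType) (C alpha beta : R) (m : nat)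
    (Z : seq R) (x : R) : R :=
  C * x ^+ m * expR (- alpha * x ^+ 2 + beta * x) *
  \prod_(r <- Z) genus1_factor r x.

(** The zero at the origin is repeated m times, so that the monomial is treated as
    m further factors. *)
Definition hadamard_zeros (R : realType) (m : nat) (Z : seq R) : seq R := nseq m 0 ++ Z.

Lemma hadamard_product_reflect (R : realType) (C alpha beta c s : R) (m : nat)
    (Z : seq R) :
  0 <= alpha -> {in Z, forall r, r != 0} ->
  {in hadamard_zeros m Z, forall z, c != z /\ `|s| <= `|c - z|} ->
  hadamard_product C alpha beta m Z (c + s) *
    hadamard_product C alpha beta m Z (c - s) <=
  hadamard_product C alpha beta m Z c ^+ 2 *
    \prod_(z <- hadamard_zeros m Z) reflection_weight c s z.
Proof.
move=> alpha0 Z0 far; rewrite /hadamard_product.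
set e := fun x => expR (- alpha * x ^+ 2 + beta * x).
set p := fun x : R => \prod_(r <- Z) genus1_factor r x.
have eE : e (c + s) * e (c - s) = e c ^+ 2 * expR (- (2 * alpha * s ^+ 2)).
  by rewrite [e c ^+ 2]expr2 /e -!expRD; congr expR; ring.
have pE : p (c + s) * p (c - s) = p c ^+ 2 * \prod_(r <- Z) reflection_weight c s r.
  apply: (@prod_reflect R R Z (@genus1_factor R) id) => r rZ.
  apply: genus1_factor_reflect; first exact: Z0.
  by apply: (far _ _).1; rewrite mem_cat rZ orbT.
have mE : (c + s) ^+ m * (c - s) ^+ m =
    (c ^+ m) ^+ 2 * \prod_(z <- nseq m 0) reflection_weight c s z.
  rewrite big_nseq iter_mulr_1 -exprMn [(c ^+ m) ^+ 2]exprAC -[RHS]exprMn.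
  case: m far => [|m] far; first by rewrite !expr0.
  have [c0 _] := far 0 (mem_head _ _).
  by have := linear_reflect s c0; rewrite !subr0 => ->.
set W := \prod_(z <- hadamard_zeros m Z) _.
have WE : W = (\prod_(z <- nseq m 0) reflection_weight c s z) *
              \prod_(r <- Z) reflection_weight c s r by rewrite /W big_cat.
(* The weights may only be followed by exp (- 2 alpha s ^ 2) <= 1 in an upper
   bound because their product is nonnegative. *)
have W0 : 0 <= W.
  rewrite /W big_seq prodr_ge0 // => z /far[cz sz].
  by have /andP[] := reflection_weight01 sz cz.
rewrite -!/(e _) -![\prod_(r <- Z) genus1_factor r _]/(p _).
have -> : C * (c + s) ^+ m * e (c + s) * p (c + s) *
    (C * (c - s) ^+ m * e (c - s) * p (c - s)) =
  C ^+ 2 * ((c + s) ^+ m * (c - s) ^+ m) * (e (c + s) * e (c - s)) *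
    (p (c + s) * p (c - s)).
  by ring.
rewrite eE pE mE.
set q := expR (- _); have q1 : q <= 1.
  by rewrite /q -expR0 ler_expR oppr_le0 mulr_ge0 ?sqr_ge0 ?mulr_ge0.
have -> : forall u v : R,
    C ^+ 2 * ((c ^+ m) ^+ 2 * u) * (e c ^+ 2 * q) * (p c ^+ 2 * v) =
    (C * c ^+ m * e c * p c) ^+ 2 * (u * v) * q by move=> u v; ring.
by rewrite -WE ler_piMr // mulr_ge0 ?sqr_ge0 //.
Qed.

Lemma hadamard_zeros_root (R : realType) (C alpha beta : R) m (Z : seq R) z :
  z \in hadamard_zeros m Z -> {in Z, forall r, r != 0} ->
  hadamard_product C alpha beta m Z z = 0.
Proof.
rewrite /hadamard_product mem_cat mem_nseq => /orP[/andP[m0 /eqP->]|zZ] Z0.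
  by rewrite expr0n eqn0Ngt m0 mulr0 !mul0r.
by rewrite (big_rem z) //= /genus1_factor divff ?Z0 // subrr mul0r mul0r mulr0.
Qed.

Lemma zero_free_ball (R : realType) (f : R -> R) (c : R) :
  {for c, continuous f} -> f c != 0 ->
  exists2 d, 0 < d & forall z, f z = 0 -> d <= `|c - z|.
Proof.
move=> fc /(cvgr_neq0 (f c) fc) /nbhs_ballP[d /= d0 dball].
exists d => // z fz; rewrite leNgt; apply/negP => cz.
by have := dball z cz; rewrite fz eqxx.
Qed.

Lemma two_zeros_reflect (R : realType) (f : R -> R) (c s xi xj : R) (Z : seq R) :
  f (c + s) * f (c - s) <= f c ^+ 2 * \prod_(z <- Z) reflection_weight c s z ->
  {in Z, forall z, c != z /\ `|s| <= `|c - z|} -> xi \in Z -> xj \in Z -> xi != xj ->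
  f (c + s) * f (c - s) <=
  f c ^+ 2 * (reflection_weight c s xi * reflection_weight c s xj).
Proof.
move=> fle far xiZ xjZ xij; apply: le_trans fle _.
rewrite ler_wpM2l ?sqr_ge0 // prod_le_two_factors // => z /far[cz sz].
exact: reflection_weight01.
Qed.

Lemma real_rooted_poly_reflect (R : realType) (p : {poly R}) (c s xi xj : R) :
  only_real_zeros p -> p.[c] != 0 ->
  (forall z, p.[z] = 0 -> c != z /\ `|s| <= `|c - z|) ->
  p.[xi] = 0 -> p.[xj] = 0 -> xi != xj ->
  p.[c + s] * p.[c - s] <=
  p.[c] ^+ 2 * (reflection_weight c s xi * reflection_weight c s xj).
Proof.
move=> /real_zeros_split[Z pE] pc0 far pi pj xij.
have hE x : p.[x] = lead_coef p * \prod_(z <- Z) (x - z).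
  rewrite {1}pE hornerZ horner_prod; congr (_ * _).
  by apply: eq_bigr => z _; rewrite hornerXsubC.
have zZ z : (z \in Z) <-> p.[z] = 0.
  have l0 : lead_coef p != 0.
    by apply: contra_neq pc0; rewrite hE => ->; rewrite mul0r.
  rewrite hE; split=> [zZ|/eqP].
    by rewrite (big_rem z) //= subrr mul0r mulr0.
  rewrite mulf_eq0 (negPf l0) prodf_seq_eq0 => /hasP[y yZ /=].
  by rewrite subr_eq0 => /eqP->.
have Zfar : {in Z, forall z, c != z /\ `|s| <= `|c - z|}.
  by move=> z /zZ; exact: far.
apply: (@two_zeros_reflect _ (horner p) _ _ _ _ Z) => //; [|exact/zZ..].
rewrite !hE mulrACA (prod_reflect (z := id) (g := fun z x => x - z)).
  by rewrite exprMn expr2 mulrA.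
by move=> z /Zfar[cz _]; exact: linear_reflect.
Qed.

Lemma hadamard_zero_split (R : realType) (C e x y : R) (m : nat) :
  C != 0 -> C * x ^+ m * expR e * y = 0 -> (x = 0 /\ (0 < m)%N) \/ y = 0.
Proof.
move=> C0 /eqP.
rewrite !mulf_eq0 (negPf C0) (gt_eqF (expR_gt0 _)) orbF /= expf_eq0.
by move=> /orP[/andP[m0 /eqP]|/eqP]; [left|right].
Qed.

Lemma finite_hadamard_reflect (R : realType) (f : R -> R) (C alpha beta : R)
    (m n : nat) (r : 'I_n -> R) (c s xi xj : R) :
  0 <= alpha -> (forall i, r i != 0) ->
  (forall x, f x = C * x ^+ m * expR (- alpha * x ^+ 2 + beta * x) *
    \prod_(i < n) genus1_factor (r i) x) -> f c != 0 ->
  (forall z, f z = 0 -> c != z /\ `|s| <= `|c - z|) ->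
  f xi = 0 -> f xj = 0 -> xi != xj ->
  f (c + s) * f (c - s) <=
  f c ^+ 2 * (reflection_weight c s xi * reflection_weight c s xj).
Proof.
move=> alpha0 r0 fE fc0 far fi fj xij.
have C0 : C != 0 by apply: contra_neq fc0; rewrite fE => ->; rewrite !mul0r.
pose Z := [seq r i | i <- enum 'I_n].
have Z0 : {in Z, forall r, r != 0} by move=> _ /mapP[i _ ->].
have fE' x : f x = hadamard_product C alpha beta m Z x.
  by rewrite fE /hadamard_product /Z big_map big_enum.
have mem z : f z = 0 -> z \in hadamard_zeros m Z.
  rewrite mem_cat mem_nseq fE => /(hadamard_zero_split C0)[[-> ->]|].
    by rewrite eqxx.
  move/eqP => /prodf_eq0[i _ gi]; apply/orP; right.
  apply/mapP; exists i; rewrite ?mem_enum //; apply/eqP; rewrite eq_sym.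
  by apply: contraTT gi => /genus1_factor_neq0; apply.
have Zfar : {in hadamard_zeros m Z, forall z, c != z /\ `|s| <= `|c - z|}.
  by move=> z zZ; apply: far; rewrite fE' hadamard_zeros_root.
apply: (two_zeros_reflect _ Zfar); [|exact: mem..|by []].
by rewrite !fE'; exact: hadamard_product_reflect.
Qed.

(** The inequality holds for every partial product that already contains the
    factors of xi and xj, and these converge at the three points involved. *)
Lemma infinite_hadamard_reflect (R : realType) (f P : R -> R)
    (C alpha beta : R) (m : nat) (r : R^nat) (c s xi xj : R) :
  0 <= alpha -> (forall i, r i != 0) ->
  cvgn (series (fun i => (r i) ^- 2)) ->
  (forall x, (fun n => \prod_(i < n) genus1_factor (r i) x) @ \oo --> P x) ->
  (forall x, f x = C * x ^+ m * expR (- alpha * x ^+ 2 + beta * x) * P x) ->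
  f c != 0 -> (forall z, f z = 0 -> c != z /\ `|s| <= `|c - z|) ->
  f xi = 0 -> f xj = 0 -> xi != xj ->
  f (c + s) * f (c - s) <=
  f c ^+ 2 * (reflection_weight c s xi * reflection_weight c s xj).
Proof.
move=> alpha0 r0 cr cP fE fc0 far fi fj xij.
have C0 : C != 0 by apply: contra_neq fc0; rewrite fE => ->; rewrite !mul0r.
pose Z n := [seq r i | i <- index_iota 0 n].
have Z0 n : {in Z n, forall r, r != 0} by move=> _ /mapP[i _ ->].
pose g n x := hadamard_product C alpha beta m (Z n) x.
have gf x : g n x @[n --> \oo] --> f x.
  rewrite fE; apply: cvgM; first exact: cvg_cst.
  rewrite [X in X @ \oo](_ : _ = (fun n => \prod_(i < n) genus1_factor (r i) x)) //.
  by apply/funext => n; rewrite big_map big_mkord.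
(* This keeps the zeros of the partial products away from c, uniformly in n. *)
have r_root i : f (r i) = 0.
  rewrite fE; suff -> : P (r i) = 0 by rewrite mulr0.
  have /cvg_lim <- // := cP (r i); apply: cvg_lim => //.
  apply: cvg_near_cst; exists i.+1 => // n /= ni.
  apply/eqP/prodf_eq0; exists (Ordinal ni) => //=.
  by rewrite /genus1_factor divff // subrr mul0r.
have mem z : f z = 0 -> \forall n \near \oo, z \in hadamard_zeros m (Z n).
  move=> fz; move: (fz); rewrite fE => /(hadamard_zero_split C0)[[-> m0]|Pz].
    by near=> n; rewrite mem_cat mem_nseq m0 eqxx.
  have [i riz] : exists i, r i = z.
    apply: contra_eqP Pz => nri; apply: (genus1_product_neq0 r0 cr (cP z)) => i.
    by apply: contra_notP nri => /negP; rewrite negbK => /eqP; exists i.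
  exists i.+1 => // n /= ni; rewrite mem_cat; apply/orP; right.
  by apply/mapP; exists i; rewrite // mem_index_iota.
have Zfar n : {in hadamard_zeros m (Z n), forall z, c != z /\ `|s| <= `|c - z|}.
  move=> z; rewrite mem_cat mem_nseq => zZ; apply: far; move: zZ.
  move=> /orP[/andP[m0 /eqP->]|/mapP[i _ ->]] //.
  by rewrite fE expr0n eqn0Ngt m0 mulr0 !mul0r.
apply: (ler_cvg_to (cvgM (gf _) (gf _)) (cvgM (cvgM (gf c) (gf c)) (cvg_cst _))).
near=> n.
apply: (two_zeros_reflect _ (Zfar n)) => //; [|near: n; exact: mem..].
exact: hadamard_product_reflect.
Unshelve. all: by end_near. Qed.

(** The radius is the distance from c to the zero set of f, or any smaller one: it
    keeps every weight nonnegative, so that discarding weights enlarges the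
    product. *)
Lemma laguerre_polya_reflect (R : realType) (f : R -> R) (c xi xj : R) :
  laguerre_polya f -> f c != 0 -> f xi = 0 -> f xj = 0 -> xi != xj ->
  exists2 d, 0 < d & forall s, `|s| <= d ->
    f (c + s) * f (c - s) <=
    f c ^+ 2 * (reflection_weight c s xi * reflection_weight c s xj).
Proof.
move=> fLP fc0 fi fj xij.
have [d d0 dz] : exists2 d, 0 < d & forall z, f z = 0 -> d <= `|c - z|.
  apply: zero_free_ball => //; have [f1 [_ [df1 _]]] := laguerre_polya_derive2 fLP.
  by apply/differentiable_continuous/derivable1_diffP; case: (df1 c).
exists d => // s sd.
have far z : f z = 0 -> c != z /\ `|s| <= `|c - z|.
  move=> fz; split; first by apply: contra_neq fc0 => ->.
  exact: le_trans (dz _ fz).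
case: fLP => [[p [preal fE]]|].
  have far' z : p.[z] = 0 -> c != z /\ `|s| <= `|c - z| by rewrite -fE; exact: far.
  by rewrite !fE; apply: real_rooted_poly_reflect far' _ _ _; rewrite -?fE.
move=> [_ [C [alpha [beta [m [P [alpha0 [[n [r [r0 PE]]]|[r [r0 cr cP]]] fE]]]]]]].
  apply: (@finite_hadamard_reflect _ f C alpha beta m n r) => // x.
  by rewrite fE PE.
exact: (@infinite_hadamard_reflect _ f P C alpha beta m r).
Qed.

(** * The logarithmic derivative between two zeros *)

(** This is - t'(c) >= 1 / (c - xi)^2 + 1 / (c - xj)^2 multiplied by f(c)^2.  Half
    of the second derivative at s = 0 of
      f(c)^2 (1 - s^2 / (c - xi)^2) (1 - s^2 / (c - xj)^2) - f(c + s) f(c - s),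
    which vanishes to first order and is nonnegative for small s, is the
    right-hand side minus the left-hand side. *)
Lemma laguerre_polya_log_concavity (R : realType) (f f1 f2 : R -> R) (c xi xj : R) :
  laguerre_polya f -> (forall x, is_derive x (1 : R) f (f1 x)) ->
  (forall x, is_derive x (1 : R) f1 (f2 x)) ->
  f c != 0 -> f xi = 0 -> f xj = 0 -> xi != xj ->
  f c ^+ 2 * ((c - xi) ^- 2 + (c - xj) ^- 2) <= f1 c ^+ 2 - f c * f2 c.
Proof.
move=> fLP df1 df2 fc0 fi fj xij.
have [d d0 refl] := laguerre_polya_reflect fLP fc0 fi fj xij.
set A := (c - xi) ^- 2; set B := (c - xj) ^- 2.
pose F s := f c ^+ 2 * ((1 - A * s ^+ 2) * (1 - B * s ^+ 2)) - f (c + s) * f (c - s).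
pose F1 s := f c ^+ 2 * (4 * A * B * s ^+ 3 - 2 * (A + B) * s) -
   (f1 (c + s) * f (c - s) - f (c + s) * f1 (c - s)).
have dplus (g g1 : R -> R) (s : R) : (forall x, is_derive x (1 : R) g (g1 x)) ->
    is_derive s (1 : R) (fun s => g (c + s)) (g1 (c + s)).
  move=> dg; rewrite -[g1 _]mulr1; apply: (@is_derive1_comp _ g (fun s => c + s)).
  by apply: is_derive_eq; ring.
have dminus (g g1 : R -> R) (s : R) : (forall x, is_derive x (1 : R) g (g1 x)) ->
    is_derive s (1 : R) (fun s => g (c - s)) (- g1 (c - s)).
  move=> dg; rewrite -[- g1 _]mulrN1; apply: (@is_derive1_comp _ g (fun s => c - s)).
  by apply: is_derive_eq; ring.
have dF x : is_derive x (1 : R) F (F1 x).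
  have := dplus _ _ x df1; have := dminus _ _ x df1 => ? ?.
  by apply: is_derive_eq; rewrite /F1 /GRing.scale /=; ring.
have dF1 : is_derive 0 (1 : R) F1
    (- (2 * (f c ^+ 2 * (A + B))) - 2 * (f c * f2 c) + 2 * f1 c ^+ 2).
  have := dplus _ _ 0 df1; have := dminus _ _ 0 df1 => ? ?.
  have := dplus _ _ 0 df2; have := dminus _ _ 0 df2 => ? ?.
  by apply: is_derive_eq; rewrite /GRing.scale /= !(addr0, subr0); ring.
suff : 0 <= - (2 * (f c ^+ 2 * (A + B))) - 2 * (f c * f2 c) + 2 * f1 c ^+ 2 by lra.
apply: (min_snd_derive_ge0 dF dF1 _ _ d0).
- by rewrite /F !(addr0, subr0); ring.
- by rewrite /F1 !(addr0, subr0); ring.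
- move=> s /andP[s0 sd]; rewrite /F subr_ge0.
  have := refl s; rewrite /reflection_weight gtr0_norm // => /(_ (ltW sd)).
  by rewrite ![_ / (c - _) ^+ 2]mulrC.
Qed.

Lemma sum_inv_sqr_ge8 (R : realFieldType) (c x y : R) : x < c < y ->
  8 / (x - y) ^+ 2 <= (c - x) ^- 2 + (c - y) ^- 2.
Proof.
move=> /andP[xc cy].
pose u := c - x; pose v := y - c.
have u0 : 0 < u by rewrite subr_gt0.
have v0 : 0 < v by rewrite subr_gt0.
have -> : (x - y) ^+ 2 = (u + v) ^+ 2 by rewrite /u /v; ring.
have -> : (c - y) ^- 2 = v ^- 2 by rewrite /v -[c - y]opprB sqrrN.
rewrite -/u; have uv0 : 0 < u + v by rewrite addr_gt0.
rewrite ler_pdivrMr ?exprn_gt0 // -subr_ge0.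
have -> : (u ^- 2 + v ^- 2) * (u + v) ^+ 2 - 8 =
  (u - v) ^+ 2 * ((u + v) ^+ 2 + 2 * (u * v)) / (u ^+ 2 * v ^+ 2).
  by field; rewrite !gt_eqF.
have uv : 0 <= u * v by rewrite mulr_ge0 // ltW.
by rewrite divr_ge0 // mulr_ge0 ?sqr_ge0 // addr_ge0 ?sqr_ge0 // mulr_ge0.
Qed.

Theorem theorem2 (R : realType) (f a b : R -> R) (D : set R) (xi xj : R)
  (f_LP : laguerre_polya f)
  (f_neq0 : exists x, f x != 0)
  (f_ode : satisfies_ode f a b D)
  (f_simple : only_simple_zeros f)
  (f_xi : f xi = 0) (f_xj : f xj = 0) (lt_xi_xj : xi < xj)
  (a_meets_t : exists c,
     [/\ xi < c < xj, D c, f c != 0 & a c = log_derivative f c]) :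
  (ereal_inf [set (8 / discriminant a b x)%:E
                | x in [set x | [/\ xi < x < xj, D x
                                  & discriminant a b x != 0]]]%R
   <= ((xi - xj) ^+ 2)%:E)%E.
Proof.
have [c [xic Dc fc0 ac]] := a_meets_t.
have [f1 [f2 [df1 df2]]] := laguerre_polya_derive2 f_LP.
have f1E : derive1 f = f1 by apply/funext => x; rewrite derive1E; case: (df1 x).
have f2E : derive1 f1 c = f2 c by rewrite derive1E; case: (df2 c).
have xij : xi != xj by rewrite lt_eqF.
have dxij : 0 < (xi - xj) ^+ 2 by rewrite exprn_even_gt0 //= subr_eq0.
have DeltaE : discriminant a b c * f c ^+ 2 = f1 c ^+ 2 - f c * f2 c.
  have := f_ode c Dc; rewrite /derive1n /= f1E f2E /discriminant ac /log_derivative f1E.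
  move=> ode; have -> : b c = (2 * (f1 c / f c) * f1 c - f2 c) / f c.
    by apply: (mulIf fc0); rewrite divfK //; move: ode; lra.
  by field.
have Delta_ge : 8 / (xi - xj) ^+ 2 <= discriminant a b c.
  apply: (le_trans (sum_inv_sqr_ge8 xic)).
  have fc2 : 0 < f c ^+ 2 by rewrite exprn_even_gt0.
  rewrite -(ler_pM2r fc2) DeltaE mulrC.
  exact: laguerre_polya_log_concavity f_LP df1 df2 fc0 f_xi f_xj xij.
have Delta0 : 0 < discriminant a b c by apply: lt_le_trans Delta_ge; rewrite divr_gt0.
apply: (@le_trans _ _ (8 / discriminant a b c)%:E).
  by apply: ereal_inf_lbound; exists c => //; split; rewrite // gt_eqF.
by rewrite lee_fin ler_pdivrMr // mulrC -ler_pdivrMr.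
Qed.
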